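(* Let $U$ and $V$ be two triangulations of a convex polygon $\pi$, and let $(a,b)$ and $(b,c)$ be two clockwise oriented boundary edges on $\pi$. If the vertices $a$, $c$, $\mathrm{lk}_U(\{a,b\})$ and $\mathrm{lk}_U(\{b,c\})$ are pairwise distinct and $\{a,c\}$ is an edge of $V$, then $\vartheta(\{U,V\},a)$ and $\vartheta(\{U,V\},b)$ cannot both be less than $2$.
   Context: An edge on a convex polygon is a set of two of its vertices; two edges cross if they are disjoint but their convex hulls intersect. A triangulation is an inclusion-maximal set of pairwise non-crossing edges. A flip replaces an interior edge $\varepsilon$ of a triangulation $T$ by the other diagonal of the unique quadrilateral having $\varepsilon$ as a diagonal and its four sides in $T$. A path from $U$ to $V$ is a sequence of triangulations starting at $U$, ending at $V$, consecutive ones differing by a flip; it is geodesic if its number of flips is minimal. A clockwise oriented boundary edge $(a,b)$ is a pair of vertices with $b$ immediately following $a$ clockwise. For a triangulation $T$, $\mathrm{lk}_T(\{a,b\})$ is the unique vertex $x$ with $\{a,x\},\{b,x\}\in T$. A flip from $T$ to $T'$ is incident to $\{a,b\}$ if $\mathrm{lk}_T(\{a,b\})\neq\mathrm{lk}_{T'}(\{a,b\})$. For a vertex $a$ with clockwise successor $b$, $\vartheta(\{U,V\},a)$ is the maximum, over all geodesic paths between $U$ and $V$, of the number of flips incident to $\{a,b\}$ along the path. *)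

(* Defs.v *)
From mathcomp Require Import all_boot all_order all_algebra.
From mathcomp Require Import boolp classical_sets reals.

Set Implicit Arguments.
Unset Strict Implicit.
Unset Printing Implicit Defensive.

Import GRing.Theory Num.Theory.
Local Open Scope ring_scope.

(* Twice the signed area of the triangle x y z; negative iff x, y, z is a
   clockwise turn. *)
Definition orient (R : realType) (x y z : 'rV[R]_2) : R :=
  (y 0 0 - x 0 0) * (z 0 1 - x 0 1) - (y 0 1 - x 0 1) * (z 0 0 - x 0 0).

(* The points p 0, ..., p (n - 1) are the vertices, in clockwise order, of a
   (strictly) convex polygon. Vertices are then referred to by their index, so
   that the clockwise successor of a is ordS a. *)
Definition convex_polygon (R : realType) (n : nat) (p : 'I_n -> 'rV[R]_2) :
    Prop :=
  (3 <= n)%N /\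
  forall i j k : 'I_n, (i < j)%N -> (j < k)%N -> orient (p i) (p j) (p k) < 0.

Definition conv_hull (R : realType) (n : nat) (p : 'I_n -> 'rV[R]_2)
    (e : {set 'I_n}) : set 'rV[R]_2 :=
  [set x | exists w : 'I_n -> R,
    [/\ forall i, 0 <= w i,
        \sum_(i in e) w i = 1 &
        x = \sum_(i in e) w i *: p i]]%classic.

Local Open Scope nat_scope.

Definition is_edge (n : nat) (e : {set 'I_n}) : bool := #|e| == 2.

Definition clockwise_boundary_edge (n : nat) (a b : 'I_n) : bool :=
  b == ordS a.

Definition interior_edge (n : nat) (e : {set 'I_n}) : bool :=
  is_edge e &&
  ~~ [exists a, exists b, clockwise_boundary_edge a b && (e == [set a; b])].

Definition crosses (R : realType) (n : nat) (p : 'I_n -> 'rV[R]_2)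
    (e f : {set 'I_n}) : bool :=
  [disjoint e & f] && `[< (conv_hull p e `&` conv_hull p f !=set0)%classic >].

Definition noncrossing (R : realType) (n : nat) (p : 'I_n -> 'rV[R]_2)
    (T : {set {set 'I_n}}) : bool :=
  [forall e in T, is_edge e] &&
  [forall e in T, forall f in T, ~~ crosses p e f].

Definition triangulation (R : realType) (n : nat) (p : 'I_n -> 'rV[R]_2)
    (T : {set {set 'I_n}}) : bool :=
  maxset (noncrossing p) T.

(* The flipped edge is {a, c}; the quadrilateral has vertices a, b, c, d, and
   its diagonals {a, c} and {b, d} are the two of its vertex pairs that
   cross. *)
Definition flip (R : realType) (n : nat) (p : 'I_n -> 'rV[R]_2) :
    rel {set {set 'I_n}} := fun T T' =>
  [exists a : 'I_n, exists b : 'I_n, exists c : 'I_n, exists d : 'I_n,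
    [&& [set a; c] \in T, interior_edge [set a; c],
        crosses p [set a; c] [set b; d],
        [set a; b] \in T, [set b; c] \in T,
        [set c; d] \in T, [set d; a] \in T &
        T' == [set b; d] |: (T :\ [set a; c])]].

(* The path U :: s; its number of flips is size s. *)
Definition flip_path (R : realType) (n : nat) (p : 'I_n -> 'rV[R]_2)
    (U V : {set {set 'I_n}}) (s : seq {set {set 'I_n}}) : bool :=
  [&& all (triangulation p) (U :: s), path (flip p) U s & last U s == V].

Definition geodesic (R : realType) (n : nat) (p : 'I_n -> 'rV[R]_2)
    (U V : {set {set 'I_n}}) (s : seq {set {set 'I_n}}) : Prop :=
  flip_path p U V s /\
  forall s', flip_path p U V s' -> size s <= size s'.

(* The vertex x such that {v, x} is in T for both vertices v of e. It exists
   and is unique when T is a triangulation and e a boundary edge. *)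
Definition lk (n : nat) (T : {set {set 'I_n}}) (e : {set 'I_n}) : option 'I_n :=
  [pick x | [forall v in e, [set v; x] \in T]].

Definition incident (n : nat) (e : {set 'I_n}) : rel {set {set 'I_n}} :=
  fun T T' => lk T e != lk T' e.

Definition incident_flips (n : nat) (e : {set 'I_n})
    (U : {set {set 'I_n}}) (s : seq {set {set 'I_n}}) : nat :=
  count id (pairmap (incident e) U s).

(* The maximum exists when U and V are triangulations: the flip graph is
   connected and geodesics all have the same length. The default value 0 of
   xget is then not used. Reversing a path preserves its length and its number
   of incident flips, so theta is symmetric in U and V. *)
Definition theta (R : realType) (n : nat) (p : 'I_n -> 'rV[R]_2)
    (U V : {set {set 'I_n}}) (a : 'I_n) : nat :=
  let e := [set a; ordS a] in
  xget 0 [set m | (exists2 s, geodesic p U V s & incident_flips e U s = m) /\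
                  forall s, geodesic p U V s -> incident_flips e U s <= m
         ]%classic.

(* Main.v *)
(* Consider the first flip of a geodesic from U to V that creates {a, c}. Only
   edges ending at b cross {a, c}, so this flip replaces some {b, x} and moves
   the links of {a, b} and {b, c} from x to c and to a respectively. If it is
   the only flip of the geodesic incident to either boundary edge, then both
   links were already x in U, against their being distinct. A geodesic exists
   because the flip graph is connected: flips lead from any triangulation to
   the fan of edges at vertex 0. Convexity is only used to see that two edges
   cross exactly when their endpoints interleave. *)
Require Import Defs.
From mathcomp Require Import all_boot all_order all_algebra.
From mathcomp Require Import boolp classical_sets reals.
From mathcomp Require Import zify ring lra.
(* Imported last because classical_sets has its own subsetP, setUC, etc. *)
From mathcomp Require Import fintype finset.

Set Implicit Arguments.
Unset Strict Implicit.
Unset Printing Implicit Defensive.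

Import Order.TTheory GRing.Theory Num.Theory.

(** * Interleaving pairs of indices *)

(** The pair i, j cuts the remaining indices into two arcs, [between] and [outside]; i and j lie on
    neither. Both are symmetric in i and j because edges are unordered. *)
Definition between (i j k : nat) : bool := (i < k < j) || (j < k < i).

Definition outside (i j k : nat) : bool :=
  ((k < i) && (k < j)) || ((i < k) && (j < k)).

Definition interleave (i j k l : nat) : bool :=
  (between i j k && outside i j l) || (between i j l && outside i j k).

Lemma interleave_sym (a b c d : nat) : interleave a b c d = interleave c d a b.
Proof. by rewrite /interleave /between /outside; lia. Qed.

Lemma interleave_swapl (a b c d : nat) : interleave a b c d = interleave b a c d.
Proof. by rewrite /interleave /between /outside; lia. Qed.

Lemma interleave_swapr (a b c d : nat) : interleave a b c d = interleave a b d c.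
Proof. by rewrite /interleave /between /outside; lia. Qed.

Lemma interleave_rot (a b c d : nat) : interleave b d c a = interleave a c b d.
Proof. by rewrite interleave_sym interleave_swapl. Qed.

Lemma interleave_shared (a b c d : nat) :
  [|| a == c, a == d, b == c | b == d] -> interleave a b c d = false.
Proof. by rewrite /interleave /between /outside; lia. Qed.

Lemma interleave_ordered (a b c d : nat) : a < c -> between a c b ->
  interleave a c b d = outside a c d.
Proof. by rewrite /interleave /between /outside; lia. Qed.

(** A pair crossing {a, c} has one end on each arc. If its end on the arc of b were not b itself,
    {a, b} or {b, c} would separate it from the other end; the sides at d likewise force the other
    end to be d. *)
Lemma quadrilateral_crossing (a b c d x y : nat) : interleave a c b d ->
  ~~ interleave a b x y -> ~~ interleave b c x y ->
  ~~ interleave c d x y -> ~~ interleave d a x y -> interleave a c x y ->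
  (x = b /\ y = d) \/ (x = d /\ y = b).
Proof.
wlog ac : a c / a < c.
  move=> W abcd nab nbc ncd nda acxy; case: (ltngtP a c) => [lt|lt|e].
  - exact: W lt _ _ _ _ _ _.
  - apply: (W c a lt); first [by rewrite interleave_swapl |
      by rewrite [interleave _ _ x y]interleave_swapl].
  - by move: abcd; rewrite e /interleave /between /outside; lia.
wlog bac : b d / between a c b.
  move=> W abcd nab nbc ncd nda acxy; case/orP: (abcd) => /andP[h _].
    exact: (W b d).
  have [] // := W d b h; try by
    [rewrite interleave_swapr | rewrite interleave_swapl].
  - by right.
  - by left.
wlog xac : x y / between a c x.
  move=> W abcd nab nbc ncd nda acxy; case/orP: (acxy) => /andP[h _].
    exact: (W x y).
  have := W y x h abcd; rewrite ![interleave _ _ y x]interleave_swapr.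
  by case=> // -[-> ->]; auto.
rewrite (interleave_ordered _ ac bac) => dout nab nbc ncd nda.
rewrite (interleave_ordered _ ac xac) => yout.
have xb : x = b.
  clear ncd nda dout; move: bac xac yout nab nbc.
  by rewrite /interleave /between /outside; lia.
left; split=> //; subst x; clear nab nbc; move: bac dout yout ncd nda.
by rewrite /interleave /between /outside; lia.
Qed.

(** * Crossing of edges as interleaving of indices *)

Section Geometry.
Local Open Scope ring_scope.
Variables (R : realType) (n : nat) (p : 'I_n -> 'rV[R]_2).
Hypothesis p_convex : convex_polygon p.

Lemma orient_cycle (x y z : 'rV[R]_2) : orient y z x = orient x y z.
Proof. by rewrite /orient; ring. Qed.

Lemma orient_swap (x y z : 'rV[R]_2) : orient y x z = - orient x y z.
Proof. by rewrite /orient; ring. Qed.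

Lemma orient_affine (x y z t : 'rV[R]_2) (u v : R) : u + v = 1 ->
  orient x y (u *: z + v *: t) = u * orient x y z + v * orient x y t.
Proof.
move=> uv; have -> : u = 1 - v by lra.
by rewrite /orient !mxE; ring.
Qed.

Lemma convex_comb_gt0 (s t x y : R) :
  0 <= s -> 0 <= t -> s + t = 1 -> 0 < x -> 0 < y -> 0 < s * x + t * y.
Proof.
move=> s0 t0 st x0 y0; have [t_eq0|t_neq0] := eqVneq t 0.
  by rewrite t_eq0 addr0 in st; rewrite t_eq0 st mul0r addr0 mul1r.
have ty : 0 < t * y by rewrite mulr_gt0 // lt0r t_neq0.
by rewrite ltr_wpDl // mulr_ge0 // ltW.
Qed.

Lemma conv_hull_pair (i j : 'I_n) (x : 'rV[R]_2) : i != j ->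
  conv_hull p [set i; j] x <->
  exists u v, [/\ 0 <= u, 0 <= v, u + v = 1 & x = u *: p i + v *: p j].
Proof.
move=> ij; have ijE : i \notin [set j] by rewrite inE.
split=> [[w [w_ge0]]|[u [v [u_ge0 v_ge0 uv ->]]]].
  rewrite !big_setU1 //= !big_set1 => w1 ->.
  by exists (w i), (w j); split.
exists (fun k => if k == i then u else v).
rewrite !big_setU1 //= !big_set1 eqxx [j == i]eq_sym (negbTE ij).
by split=> // k; case: ifP.
Qed.

Lemma orient_lt0 (i j k : 'I_n) : (i < j)%N -> outside i j k ->
  orient (p i) (p j) (p k) < 0.
Proof.
case: p_convex => _ cvx ij; rewrite /outside => /orP[/andP[ki _]|/andP[_ jk]].
  by rewrite orient_cycle; apply: cvx.
exact: cvx.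
Qed.

Lemma orient_gt0 (i j k : 'I_n) : (i < j)%N -> between i j k ->
  0 < orient (p i) (p j) (p k).
Proof.
case: p_convex => _ cvx ij; rewrite /between => /orP[/andP[ik kj]|]; last by lia.
by rewrite orient_cycle orient_swap oppr_gt0; apply: cvx.
Qed.

Lemma conv_hull_interleave (i j k l : 'I_n) :
  (i < k)%N -> (k < j)%N -> (j < l)%N ->
  (conv_hull p [set i; j] `&` conv_hull p [set k; l] !=set0)%classic.
Proof.
case: p_convex => _ cvx ik kj jl.
have := cvx k j l kj jl; have := cvx i k l ik (ltn_trans kj jl).
have := cvx i j l (ltn_trans ik kj) jl; have := cvx i k j ik kj.
(* The affine dependence among four points in the plane has their
   orientation determinants as coefficients. *)
set D := orient (p i) (p k) (p j); set C := orient (p i) (p j) (p l).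
set B := orient (p i) (p k) (p l); set A := orient (p k) (p j) (p l).
move=> D0 C0 B0 A0.
(* Both sums are twice the signed area of the quadrilateral i, k, j, l, cut along one diagonal or
   the other. This is the common denominator of the two convex combinations. *)
have ACBD : A + B = C + D by rewrite /A /B /C /D /orient; ring.
have nz : A + B != 0 by lra.
have ratio_ge0 (x : R) : x < 0 -> 0 <= x / (A + B).
  by move=> x0; rewrite ltW // nmulr_rgt0 // invr_lt0; lra.
exists ((A / (A + B)) *: p i + (B / (A + B)) *: p j); split.
  apply/conv_hull_pair; first by rewrite -val_eqE /=; lia.
  exists (A / (A + B)), (B / (A + B)); split; rewrite ?ratio_ge0 //.
  by field.
apply/conv_hull_pair; first by rewrite -val_eqE /=; lia.
exists (C / (A + B)), (D / (A + B)); split; rewrite ?ratio_ge0 //.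
  by rewrite -mulrDl -ACBD; field.
have scaled (x y z t : R) : A * x + B * y = C * z + D * t ->
    A / (A + B) * x + B / (A + B) * y = C / (A + B) * z + D / (A + B) * t.
  move=> e; transitivity ((A * x + B * y) / (A + B)); first by field.
  by rewrite e; field.
apply/rowP => m; rewrite !mxE; apply: scaled.
rewrite /A /B /C /D /orient.
have [->|->] : m = 0 \/ m = 1.
- by case: m => [[|[|m]] hm] //; [left|right]; apply: val_inj.
- ring.
- ring.
Qed.

(** Orientation relative to [p i] and [p j] has opposite strict signs on the two arcs and vanishes
    on the hull of i and j. If k and l were on the same arc, it would keep a strict sign on their
    hull, so the hulls could not meet. *)
Lemma crosses_interleave (i j k l : 'I_n) : i != j -> k != l ->
  crosses p [set i; j] [set k; l] = interleave i j k l.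
Proof.
wlog ij : i j / (i < j)%N.
  move=> W ij kl; case: (ltngtP i j) => [lt|lt|/val_inj e]; first exact: W.
    rewrite setUC W // 1?eq_sym //.
    by rewrite /interleave /between /outside; lia.
  by rewrite e eqxx in ij.
wlog kl : k l / (k < l)%N.
  move=> W h kl; case: (ltngtP k l) => [lt|lt|/val_inj e]; first exact: W.
    rewrite [[set k; l]]setUC W // 1?eq_sym //.
    by rewrite /interleave /between /outside; lia.
  by rewrite e eqxx in kl.
move=> nij nkl; rewrite /crosses; apply/andP/idP => [[dis /asboolP[x []]]|].
  move=> /conv_hull_pair - /(_ nij)[u [v [u0 v0 uv xE]]].
  move=> /conv_hull_pair - /(_ nkl)[s [t [s0 t0 st xE']]].
  have x0 : orient (p i) (p j) x = 0.
    by rewrite xE orient_affine // /orient; ring.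
  rewrite xE' orient_affine // in x0.
  have {dis} : [&& k != i, k != j, l != i & l != j].
    move: dis; rewrite disjoint_sym disjoint_subset => /subsetP dis.
    have := dis k; have := dis l; rewrite !inE !eqxx ?orbT /= !negb_or.
    by move=> /(_ isT)/andP[-> ->] /(_ isT)/andP[-> ->].
  rewrite -!val_eqE /= => dis.
  have dich (m : 'I_n) : m != i :> nat -> m != j :> nat ->
      between i j m (+) outside i j m.
    by rewrite /between /outside; lia.
  case/and4P: dis => /dich dk /dk {}dk /dich dl /dl {}dl.
  rewrite /interleave.
  case bk: (between i j k) dk; case bl: (between i j l) dl => /=.
  - have := convex_comb_gt0 s0 t0 st (orient_gt0 ij bk) (orient_gt0 ij bl).
    by rewrite x0 ltxx.
  - by move=> ->.
  - by move=> _ ->.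
  - move=> ol ok; have [ok' ol'] := (orient_lt0 ij ok, orient_lt0 ij ol).
    rewrite -oppr_gt0 in ok'; rewrite -oppr_gt0 in ol'.
    have := convex_comb_gt0 s0 t0 st ok' ol'.
    by rewrite !mulrN -opprD x0 oppr0 ltxx.
rewrite /interleave /between /outside => H.
split.
  rewrite disjoint_subset; apply/subsetP => m; rewrite !inE.
  by rewrite -!val_eqE /=; lia.
apply/asboolP.
have [/and3P[h1 h2 h3]|/and3P[h1 h2 h3]] : [&& i < k, k < j & j < l]%N \/
    [&& k < i, i < l & l < j]%N by lia.
  exact: conv_hull_interleave.
by rewrite classical_sets.setIC; apply: conv_hull_interleave.
Qed.

End Geometry.

(** * Triangulations in terms of indices *)

Lemma ord_eqE (n : nat) (i j : 'I_n) : (i == j) = (i == j :> nat).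
Proof. by []. Qed.

Lemma ordS_val (n : nat) (a : 'I_n) :
  (ordS a = a.+1 :> nat) \/ (a.+1 = n /\ ordS a = 0 :> nat).
Proof.
have := ltn_ord a; rewrite leq_eqVlt => /orP[/eqP an|an] /=; last first.
  by left; rewrite modn_small.
by right; rewrite an modnn.
Qed.

Lemma set2_inj (T : finType) (x y z t : T) :
  [set x; y] = [set z; t] -> (x = z /\ y = t) \/ (x = t /\ y = z).
Proof.
move=> e; have: x \in [set z; t] by rewrite -e set21.
have: y \in [set z; t] by rewrite -e set22.
have: z \in [set x; y] by rewrite e set21.
have: t \in [set x; y] by rewrite e set22.
by rewrite !inE; do 4 (move=> /orP[]/eqP ?); intuition congruence.
Qed.

Section Triangulations.
Local Open Scope nat_scope.
Variables (R : realType) (n : nat) (p : 'I_n -> 'rV[R]_2).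
Hypothesis p_convex : convex_polygon p.

Implicit Types (T : {set {set 'I_n}}) (i j k l : 'I_n).

(** Since non-crossing is a condition on pairs of edges, maximality need only be tested by adding
    one edge at a time. Later arguments can then work with inequalities between indices. *)
Lemma triangulationP T : reflect
  [/\ forall e, e \in T -> exists i j, i != j /\ e = [set i; j],
      forall i j, [set i; j] \in T -> i != j,
      forall i j k l, [set i; j] \in T -> [set k; l] \in T ->
        ~~ interleave i j k l &
      forall i j, i != j ->
        (forall k l, [set k; l] \in T -> ~~ interleave i j k l) ->
        [set i; j] \in T]
  (triangulation p T).
Proof.
have edgeE (e : {set 'I_n}) : is_edge e -> exists i j, i != j /\ e = [set i; j].
  by rewrite /is_edge => /cards2P[i [j [ij ->]]]; exists i, j.
have edge2 i j : is_edge [set i; j] = (i != j).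
  by rewrite /is_edge cards2; case: (i != j).
have ncP (S : {set {set 'I_n}}) : reflect
    ((forall e, e \in S -> is_edge e) /\
     (forall e f, e \in S -> f \in S -> ~~ crosses p e f))
    (noncrossing p S).
  apply: (iffP andP) => -[h1 h2]; split.
  - by move=> e; apply: (forall_inP h1).
  - by move=> e f eS; apply: (forall_inP (forall_inP h2 e eS)).
  - by apply/forall_inP.
  - by apply/forall_inP => e eS; apply/forall_inP => f; apply: h2.
apply: (iffP maxsetP) => [[/ncP[hE hN] hM]|[hE hI hN hM]].
  have hI i j : [set i; j] \in T -> i != j by move/hE; rewrite edge2.
  split=> // [e /hE/edgeE//|i j k l ij kl|i j ij H].
    by rewrite -(crosses_interleave p_convex) ?hI // hN.
  suff <- : [set i; j] |: T = T by rewrite setU11.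
  apply: hM; last exact: subsetUr.
  have eE e : e \in [set i; j] |: T -> is_edge e.
    by rewrite !inE => /orP[/eqP->|/hE//]; rewrite edge2.
  apply/ncP; split=> // e f eS fS.
  have [x [y [xy ex]]] := edgeE _ (eE _ eS).
  have [z [t [zt ez]]] := edgeE _ (eE _ fS).
  move: eS fS; rewrite {}ex {}ez.
  rewrite (crosses_interleave p_convex) // !inE.
  move=> /orP[/eqP e1|e1] /orP[/eqP e2|e2].
  - case: (set2_inj e1) (set2_inj e2) => -[-> ->] [] [-> ->];
    by rewrite /interleave /between /outside; lia.
  - have := H _ _ e2; case: (set2_inj e1) => -[-> ->];
    by rewrite /interleave /between /outside; lia.
  - have := H _ _ e1; case: (set2_inj e2) => -[-> ->];
    by rewrite /interleave /between /outside; lia.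
  - by rewrite -(crosses_interleave p_convex) // hN.
split.
  apply/ncP; split=> [e /hE[i [j [ij ->]]]|e f eT fT]; first by rewrite edge2.
  have [i [j [ij ei]]] := hE _ eT; have [k [l [kl ek]]] := hE _ fT; subst.
  by rewrite (crosses_interleave p_convex) // hN.
move=> S /ncP[sE sN] TS; apply/eqP; rewrite eqEsubset TS andbT.
apply/subsetP => e eS; have [i [j [ij ei]]] := edgeE _ (sE _ eS); subst.
apply: hM => // k l klT; rewrite -(crosses_interleave p_convex) ?(hI k l) //.
by rewrite sN // (subsetP TS).
Qed.

(** One arc of a boundary edge is empty, so nothing crosses it and maximality puts it in T. *)
Lemma boundary_edge_in T i : triangulation p T -> [set i; ordS i] \in T.
Proof.
case: p_convex => n3 _ /triangulationP[_ _ _ hM].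
have := ordS_val i => iS; apply: hM; first by rewrite ord_eqE; lia.
move=> k l _; have := ltn_ord k; have := ltn_ord l.
by rewrite /interleave /between /outside; lia.
Qed.

(** * Quadrilaterals and flips *)

Definition quadrilateral T (a b c d : 'I_n) : bool :=
  [&& [set a; b] \in T, [set b; c] \in T, [set c; d] \in T & [set d; a] \in T].

Lemma quadrilateral_rot T (a b c d : 'I_n) :
  quadrilateral T b c d a = quadrilateral T a b c d.
Proof. by rewrite /quadrilateral; do 4 case: (_ \in T). Qed.

(** Serves to show that an edge survives the removal of {a, c} in a flip. *)
Lemma crossing_pairs_neq (a b c d i j : 'I_n) : interleave a c b d ->
  ~~ interleave i j b d -> [set i; j] != [set a; c].
Proof.
move=> abcd; apply: contra => /eqP/set2_inj[] [-> ->] //.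
by rewrite interleave_swapl.
Qed.

Lemma interior_crossed_edge (a b c d : 'I_n) :
  interleave a c b d -> interior_edge [set a; c].
Proof.
move=> abcd; apply/andP; split.
  rewrite /is_edge cards2.
  suff -> : a != c by [].
  by rewrite ord_eqE; move: abcd; rewrite /interleave /between /outside; lia.
apply/existsP => -[x /existsP[y /andP[/eqP-> /eqP e]]].
have := ltn_ord a; have := ltn_ord b; have := ltn_ord c; have := ltn_ord d.
have := ordS_val x; move: abcd; rewrite /interleave /between /outside.
by case: (set2_inj e) => -[-> ->]; lia.
Qed.

Lemma flip_inv T T' : triangulation p T -> triangulation p T' -> flip p T T' ->
  exists a b c d : 'I_n, [/\ [set a; c] \in T, interleave a c b d,
    quadrilateral T a b c d & T' = [set b; d] |: (T :\ [set a; c])].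
Proof.
move=> /triangulationP[_ hI _ _] /triangulationP[_ hI' _ _].
move=> /existsP[a /existsP[b /existsP[c /existsP[d]]]].
case/and5P => ac _ cr ab /and4P[bc cd da /eqP TE].
exists a, b, c, d; split=> //; last by rewrite /quadrilateral ab bc cd da.
rewrite -(crosses_interleave p_convex) ?(hI a c) //.
by apply: hI'; rewrite TE setU11.
Qed.

Lemma flip_intro T (a b c d : 'I_n) : [set a; c] \in T -> interleave a c b d ->
  quadrilateral T a b c d -> flip p T ([set b; d] |: (T :\ [set a; c])).
Proof.
move=> ac abcd /and4P[ab bc cd da].
have [nac nbd] : a != c /\ b != d.
  by rewrite !ord_eqE; move: abcd; rewrite /interleave /between /outside; lia.
apply/existsP; exists a; apply/existsP; exists b; apply/existsP; exists c.
apply/existsP; exists d.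
rewrite ac ab bc cd da eqxx (interior_crossed_edge abcd) /=.
by rewrite (crosses_interleave p_convex) // abcd.
Qed.

(** The sides share an endpoint with {b, d}, hence differ from {a, c} and are covered by the
    hypothesis, so [quadrilateral_crossing] applies. *)
Lemma crossing_diagonal_eq T (a b c d x y : 'I_n) :
  quadrilateral T a b c d -> interleave a c b d ->
  (forall k l, [set k; l] \in T -> [set k; l] != [set a; c] ->
    ~~ interleave k l x y) ->
  interleave a c x y -> [set x; y] = [set b; d].
Proof.
move=> /and4P[ab bc cd da] abcd H acxy.
have side (k l : 'I_n) : [set k; l] \in T -> ~~ interleave k l b d ->
    ~~ interleave k l x y.
  by move=> kl n'; apply: H => //; apply: crossing_pairs_neq abcd n'.
have [] := @quadrilateral_crossing a b c d x y abcd; try apply: side => //.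
- by rewrite interleave_shared // eqxx ?orbT.
- by rewrite interleave_shared // eqxx ?orbT.
- by rewrite interleave_shared // eqxx ?orbT.
- by rewrite interleave_shared // eqxx ?orbT.
- by [].
- by move=> [/val_inj-> /val_inj->].
- by move=> [/val_inj-> /val_inj->]; rewrite setUC.
Qed.

(** An edge of T crossing {b, d} crosses no side, so it is {a, c}. For maximality, a pair crossing
    nothing in the new set either crosses {a, c}, and is then {b, d}, or crosses nothing in T and
    was already there. *)
Lemma flip_triangulation T (a b c d : 'I_n) : triangulation p T ->
  [set a; c] \in T -> interleave a c b d -> quadrilateral T a b c d ->
  triangulation p ([set b; d] |: (T :\ [set a; c])).
Proof.
move=> tT ac abcd Q; have [hE hI hN hM] := triangulationP _ tT.
have [nac nbd] : a != c /\ b != d.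
  by rewrite !ord_eqE; move: abcd; rewrite /interleave /between /outside; lia.
have bdN k l : [set k; l] \in T -> [set k; l] != [set a; c] ->
    ~~ interleave b d k l.
  move=> kl; apply: contra => bdkl.
  move: (Q) => /and4P[ab bc cd da].
  have [] // := @quadrilateral_crossing b c d a k l.
  - by rewrite interleave_rot.
  - exact: hN.
  - exact: hN.
  - exact: hN.
  - exact: hN.
  - by move=> [/val_inj-> /val_inj->]; rewrite setUC.
  - by move=> [/val_inj-> /val_inj->].
apply/triangulationP; split.
- move=> e; rewrite !inE => /orP[/eqP->|/andP[_ /hE//]].
  by exists b, d.
- move=> i j; rewrite !inE => /orP[/eqP/set2_inj[][-> ->]//|/andP[_ /hI//]].
  by rewrite eq_sym.
- move=> i j k l; rewrite !inE.
  move=> /orP[/eqP e1|/andP[n1 e1]] /orP[/eqP e2|/andP[n2 e2]].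
  + case: (set2_inj e1) (set2_inj e2) => -[-> ->] [] [-> ->];
    by rewrite /interleave /between /outside; lia.
  + have := bdN _ _ e2 n2; case: (set2_inj e1) => -[-> ->] //.
    by rewrite interleave_swapl.
  + rewrite interleave_sym; have := bdN _ _ e1 n1.
    by case: (set2_inj e2) => -[-> ->] //; rewrite interleave_swapl.
  + exact: hN.
- move=> i j ij H.
  have H' k l : [set k; l] \in T -> [set k; l] != [set a; c] ->
      ~~ interleave i j k l.
    by move=> kl n'; apply: H; rewrite !inE n' kl orbT.
  have [acij|acij] := boolP (interleave a c i j).
    rewrite (@crossing_diagonal_eq T a b c d i j) // ?setU11 //.
    by move=> k l kl n'; rewrite interleave_sym H'.
  have ijT : [set i; j] \in T.
    apply: hM => // k l kl; have [e|ne] := eqVneq [set k; l] [set a; c].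
      rewrite interleave_sym; case: (set2_inj e) => -[-> ->] //.
      by rewrite interleave_swapl.
    exact: H'.
  have: ~~ interleave i j b d by apply: H; rewrite setU11.
  by move/(crossing_pairs_neq abcd) => n'; rewrite !inE n' ijT orbT.
Qed.

(** The same quadrilateral, rotated by one vertex, makes {b, d} the removed diagonal. *)
Lemma flip_sym T T' : triangulation p T -> triangulation p T' ->
  flip p T T' -> flip p T' T.
Proof.
move=> tT tT' /(flip_inv tT tT')[a [b [c [d [ac abcd Q TE]]]]].
have [_ _ hN _] := triangulationP _ tT.
have bdT : [set b; d] \notin T.
  by apply: contraL abcd => /(hN _ _ _ _ ac).
have bdca : interleave b d c a by rewrite interleave_rot.
have -> : T = [set c; a] |: (T' :\ [set b; d]).
  rewrite TE setU1K ?[[set c; a]]setUC ?setD1K //.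
  by rewrite !inE negb_and bdT orbT.
apply: flip_intro => //; first by rewrite TE setU11.
rewrite quadrilateral_rot; move/and4P: Q => [ab bc cd da].
have side k l : [set k; l] \in T -> ~~ interleave k l b d -> [set k; l] \in T'.
  by move=> kl /(crossing_pairs_neq abcd) n'; rewrite TE !inE n' kl orbT.
by apply/and4P; split; apply: side => //;
  rewrite interleave_shared // !eqxx ?orbT.
Qed.

(** * Connectivity of the flip graph *)

Definition flip_step : rel {set {set 'I_n}} :=
  fun T T' => [&& triangulation p T, triangulation p T' & flip p T T'].

Lemma flip_step_sym : symmetric flip_step.
Proof.
move=> T T'; apply/and3P/and3P => -[tT tT' f];
by split; [exact: tT' | exact: tT | exact: (flip_sym tT tT' f)].
Qed.

Lemma triangle_below T k j : triangulation p T -> [set k; j] \in T ->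
  k.+1 < j ->
  exists m : 'I_n, [/\ k < m < j, [set k; m] \in T & [set m; j] \in T].
Proof.
move=> tT kj lt_kj; have [_ hI hN hM] := triangulationP _ tT.
have kS : ordS k = k.+1 :> nat.
  by have := ordS_val k; have := ltn_ord j; lia.
(* The apex is the largest neighbour m of k below j. An edge crossing {m, j} but neither {k, j} nor
   {k, m} would join k to a vertex between m and j, against the choice of m. *)
pose P (m : 'I_n) := (k < m < j) && ([set k; m] \in T).
have P0 : P (ordS k) by rewrite /P boundary_edge_in // andbT kS; lia.
case: (@arg_maxnP _ _ P val P0) => m /andP[kmj km] mmax.
exists m; split=> //; apply: hM => [|x y xy].
  by rewrite ord_eqE; lia.
have := hN _ _ _ _ kj xy; have := hN _ _ _ _ km xy.
have maxl w : [set k; w] \in T -> m < w -> w < j -> False.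
  move=> kw mw wj; have : P w by rewrite /P kw andbT; lia.
  by move/mmax => /=; lia.
have yk : x = k :> nat -> m < y -> y < j -> False.
  by move=> /val_inj e; apply: maxl; rewrite -e.
have xk' : y = k :> nat -> m < x -> x < j -> False.
  by move=> /val_inj e; apply: maxl; rewrite setUC -e.
by clear -kmj yk xk'; rewrite /interleave /between /outside; lia.
Qed.

(* If k < j are consecutive neighbours of z and j > k + 1, then {k, j} is an
   edge; flipping it gives z a new neighbour. *)
Lemma flip_towards_fan T (z x : 'I_n) : z = 0 :> nat -> triangulation p T ->
  x != z -> [set z; x] \notin T ->
  exists2 T', flip_step T T' &
    [set i | [set z; i] \in T] \proper [set i | [set z; i] \in T'].
Proof.
move=> z0 tT xz zx; have [_ hI hN hM] := triangulationP _ tT.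
pose P (i : 'I_n) := (i < x) && ([set z; i] \in T).
pose Q (i : 'I_n) := (x < i) && ([set z; i] \in T).
have neqx (w : 'I_n) : [set z; w] \in T -> w != x :> nat.
  by move=> zw; apply: contraNN zx => /eqP/val_inj<-.
have x0 : 0 < x by move: xz; rewrite ord_eqE; lia.
(* The two boundary neighbours of z, of indices 1 and n - 1, lie on either side of x, so neighbours
   k and j of z closest to x exist below and above it. *)
have P0 : P (ordS z).
  rewrite /P boundary_edge_in // andbT.
  have := neqx _ (boundary_edge_in z tT); have := ordS_val z.
  by have := ltn_ord x; lia.
have Q0 : Q (ord_pred z).
  have := boundary_edge_in (ord_pred z) tT; rewrite ord_predK setUC => zp.
  rewrite /Q zp andbT; have := neqx _ zp; have := ordS_val (ord_pred z).
  by rewrite ord_predK z0; have := ltn_ord x; lia.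
case: (@arg_maxnP _ _ P val P0) => k /andP[kx zk] kmax.
case: (@arg_minnP _ _ Q val Q0) => j /andP[xj zj] jmin.
have gap (w : 'I_n) : [set z; w] \in T -> k < w < j -> False.
  move=> zw /andP[kw wj]; have := neqx _ zw; case: ltngtP => // h _.
    have /kmax /= : P w by rewrite /P h zw.
    by lia.
  have /jmin /= : Q w by rewrite /Q h zw.
  by lia.
have k0 : 0 < k by have := hI _ _ zk; rewrite ord_eqE; lia.
(* An edge crossing {k, j} but neither {z, k} nor {z, j} would end at z, with its other end in the
   gap between k and j. *)
have kj : [set k; j] \in T.
  apply: hM => [|u v uv]; first by rewrite ord_eqE; lia.
  have := hN _ _ _ _ zk uv; have := hN _ _ _ _ zj uv.
  have gu : u = z :> nat -> k < v < j -> False.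
    by move=> /val_inj e; apply: gap; rewrite -e.
  have gv : v = z :> nat -> k < u < j -> False.
    by move=> /val_inj e; apply: gap; rewrite setUC -e.
  move: gu gv; clear -z0 k0 kx xj.
  by rewrite z0 /interleave /between /outside; lia.
have [m [kmj km mj]] := triangle_below tT kj (leq_ltn_trans kx xj).
have kjmz : interleave k j m z.
  by clear -kmj z0 k0; rewrite z0 /interleave /between /outside; lia.
have quad : quadrilateral T k m j z.
  by rewrite /quadrilateral km mj zk /= setUC zj.
exists ([set m; z] |: (T :\ [set k; j])).
  by rewrite /flip_step tT flip_triangulation //= flip_intro.
(* Edges at z share an endpoint with the new edge {m, z}, so none of them is the removed {k, j}; m
   is new because it lies in the gap. *)
apply/properP; split.
  apply/subsetP => w; rewrite !inE => zw; rewrite zw andbT.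
  rewrite (crossing_pairs_neq kjmz) ?orbT //.
  by clear -kmj; rewrite /interleave /between /outside; lia.
exists m; first by rewrite inE [[set z; m]]setUC setU11.
by rewrite inE; apply/negP => /gap; apply.
Qed.

Lemma connect_fan T (z : 'I_n) : z = 0 :> nat -> triangulation p T ->
  exists F, [/\ connect flip_step T F, triangulation p F &
                forall i, i != z -> [set z; i] \in F].
Proof.
(* Induction on n minus the degree of z, which each flip towards the fan lowers. *)
move=> z0; have [k] := ubnP (n - #|[set i | [set z; i] \in T]|).
elim: k T => // k IH T Tk tT.
have [/forall_inP full|] := boolP [forall (i | i != z), [set z; i] \in T].
  by exists T; split=> //; apply: full.
rewrite negb_forall => /existsP[x]; rewrite negb_imply => /andP[xz zx].
have [T' st lt] := flip_towards_fan z0 tT xz zx.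
have [||F [cF tF fF]] := IH T'; last 1 first.
- by exists F; split=> //; apply: connect_trans cF; apply: connect1.
- have := proper_card lt; have := max_card [set i | [set z; i] \in T'].
  by rewrite card_ord; lia.
- by case/and3P: st.
Qed.

(** An edge {x, y} avoiding z can have no w between x and y, since {z, w} would cross it. Having an
    empty arc, it is crossed by nothing and lies in every triangulation. *)
Lemma fan_subset T T' (z : 'I_n) : z = 0 :> nat ->
  triangulation p T -> triangulation p T' ->
  (forall i, i != z -> [set z; i] \in T) ->
  (forall i, i != z -> [set z; i] \in T') -> T \subset T'.
Proof.
move=> z0 tT tT' zT zT'.
have [hE _ hN _] := triangulationP _ tT.
have [_ _ _ hM'] := triangulationP _ tT'.
apply/subsetP => e eT; have [x [y [xy ex]]] := hE _ eT; subst e.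
have [xz|xz] := eqVneq x z; first by rewrite xz zT' // -xz eq_sym.
have [yz|yz] := eqVneq y z; first by rewrite yz setUC zT' // -yz.
apply: hM' => // k l kl; apply/negP => xykl.
have star (w : 'I_n) : between x y w -> False.
  move=> b; have wz : w != z.
    by move: b; rewrite ord_eqE /between; lia.
  have := hN _ _ _ _ eT (zT _ wz); move: b xz yz.
  by rewrite !ord_eqE z0 /interleave /between /outside; lia.
by case/orP: xykl => /andP[/star].
Qed.

Lemma flip_connected T T' : triangulation p T -> triangulation p T' ->
  connect flip_step T T'.
Proof.
move=> tT tT'; case: p_convex => n3 _.
pose z : 'I_n := Ordinal (leq_trans (isT : 0 < 3) n3).
have [F [cF tF fF]] := connect_fan (erefl : z = 0 :> nat) tT.
have [F' [cF' tF' fF']] := connect_fan (erefl : z = 0 :> nat) tT'.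
have FE : F = F'.
  by apply/eqP; rewrite eqEsubset !(@fan_subset _ _ z).
apply: connect_trans cF _; rewrite FE.
by rewrite (sym_connect_sym flip_step_sym).
Qed.

(** * Geodesics and the maximum [theta] *)

Lemma geodesic_exists U V : triangulation p U -> triangulation p V ->
  exists s, geodesic p U V s.
Proof.
move=> tU tV; have [s sU sV] := connectP (flip_connected tU tV).
have fs : flip_path p U V s.
  rewrite /flip_path sV eqxx andbT {tV sV}.
  elim: s U tU sU => [|T s IH] U tU /=; first by rewrite tU.
  by case/andP => /and3P[_ tT ->] /(IH _ tT) /= /andP[-> ->]; rewrite tU.
have ex : exists m, `[< exists2 s', flip_path p U V s' & size s' = m >].
  by exists (size s); apply/asboolP; exists s.
case: (ex_minnP ex) => m /asboolP[s' fs' <-] mmin.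
by exists s'; split=> // t ft; apply: mmin; apply/asboolP; exists t.
Qed.

(** Incident flips are bounded by the common length of all geodesics, so the maximum is attained and
    [xget] does not fall back on its default 0. *)
Lemma incident_flips_le_theta U V a s : geodesic p U V s ->
  incident_flips [set a; ordS a] U s <= theta p U V a.
Proof.
move=> gs; set e := [set a; ordS a].
pose P m := `[< exists2 t, geodesic p U V t & incident_flips e U t = m >].
have exP : exists m, P m.
  by exists (incident_flips e U s); apply/asboolP; exists s.
have ubP m : P m -> m <= size s.
  move=> /asboolP[t [ft tmin] <-]; apply: leq_trans (tmin _ gs.1).
  by rewrite /incident_flips (leq_trans (count_size _ _)) // size_pairmap.
case: (ex_maxnP exP ubP) => m /asboolP[t gt tm] mmax.
rewrite /theta -/e; case: xgetP => [m' _ [_]|/(_ m)]; first exact.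
case; split; first by exists t.
by move=> u gu; apply: mmax; apply/asboolP; exists u.
Qed.

(** * Links of boundary edges and the ear {a, c} *)

(** For two distinct candidates x and y, one of the edges from a would cross one of those from
    [ordS a], so [pick] has only one choice. *)
Lemma lk_boundary T a x : triangulation p T ->
  [set a; x] \in T -> [set ordS a; x] \in T -> lk T [set a; ordS a] = Some x.
Proof.
move=> tT ax bx; have [_ hI hN _] := triangulationP _ tT.
have lkE y : [forall v in [set a; ordS a], [set v; y] \in T] =
    ([set a; y] \in T) && ([set ordS a; y] \in T).
  apply/forall_inP/andP => [H|[ay b'y] v].
    by split; apply: H; rewrite !inE eqxx ?orbT.
  by rewrite !inE => /orP[]/eqP->.
rewrite /lk; case: pickP => [y|/(_ x)]; rewrite lkE ?ax ?bx //.
move=> /andP[ay b'y]; congr Some; apply: val_inj => /=.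
have := hI _ _ ax; have := hI _ _ bx; have := hI _ _ ay; have := hI _ _ b'y.
have := hN _ _ _ _ ax b'y; have := hN _ _ _ _ ay bx.
have := ltn_ord x; have := ltn_ord y; have := ordS_val a.
rewrite !ord_eqE /interleave /between /outside.
move: (nat_of_ord (ordS a)) => b'; lia.
Qed.

Section Ear.
Variables a b c : 'I_n.
Hypotheses (ab : clockwise_boundary_edge a b) (bc : clockwise_boundary_edge b c).

Lemma ear_links T : triangulation p T -> [set a; c] \in T ->
  lk T [set a; b] = Some c /\ lk T [set b; c] = Some a.
Proof.
move: ab bc => /eqP -> /eqP -> tT ac; split; apply: lk_boundary => //.
- exact: boundary_edge_in.
- by rewrite setUC boundary_edge_in.
- by rewrite setUC.
Qed.

(** The quadrilateral of the flip is a, b, c, x with {b, x} removed; its sides {a, x} and {c, x}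
    complete the triangles of T on both boundary edges. *)
Lemma flip_creating_ear T T' : triangulation p T -> triangulation p T' ->
  flip p T T' -> [set a; c] \notin T -> [set a; c] \in T' ->
  exists x, [/\ lk T [set a; b] = Some x, lk T [set b; c] = Some x,
                x != a & x != c].
Proof.
move=> tT tT' f acT acT'.
have [_ hI _ _] := triangulationP _ tT.
have key x : [set a; x] \in T -> [set b; x] \in T -> [set c; x] \in T ->
    exists x, [/\ lk T [set a; b] = Some x, lk T [set b; c] = Some x,
                x != a & x != c].
  move=> ax bx cx; exists x; move: ab bc cx bx => /eqP-> /eqP-> cx bx.
  split; [exact: lk_boundary | exact: lk_boundary | |].
    by rewrite eq_sym hI.
  by rewrite eq_sym hI.
have [i [j [k [l [ik ijkl /and4P[ij jk kl li] TE]]]]] := flip_inv tT tT' f.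
move: acT'; rewrite TE !inE (negbTE acT) andbF orbF => /eqP e.
(* The vertex b is alone on its arc of {a, c}, so every crossing pair ends there. *)
have ear : interleave i k a c -> i = b \/ k = b.
  move=> h; have [/val_inj|/val_inj] : i = b :> nat \/ k = b :> nat; auto.
  move: h ab bc => h /eqP eb /eqP ec; have := ordS_val a; have := ordS_val b.
  have := ltn_ord i; have := ltn_ord k; rewrite -eb -ec.
  by clear -h; move: h; rewrite /interleave /between /outside; lia.
have sym u v : ([set u; v] \in T) = ([set v; u] \in T) by rewrite setUC.
(* Four cases: the labels of the flip may list a and c, and also b and x, in either order. *)
case: (set2_inj e) => -[ea ec]; subst j l.
  case: (ear ijkl) => eb; subst.
    by apply: (key k) => //; rewrite sym.
  by apply: (key i) => //; rewrite sym.
rewrite interleave_swapr in ijkl; case: (ear ijkl) => eb; subst.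
  by apply: (key k) => //; rewrite sym.
by apply: (key i) => //; rewrite sym.
Qed.

Lemma incident_flips_cons e T T' s : incident_flips e T (T' :: s) =
  (lk T e != lk T' e) + incident_flips e T' s.
Proof. by []. Qed.

Lemma bool_addn_lt2 (t : bool) (m : nat) : 0 < m -> t + m < 2 -> ~~ t /\ m < 2.
Proof. by case: t; case: m => [|[]]. Qed.

(** Induction along the path. The positivity claims feed the last one: if {a, c} is still to be
    created, each boundary edge has a later incident flip, so with fewer than two in all the first
    flip leaves both links unchanged. *)
Lemma ear_flip_path U V s : flip_path p U V s ->
  [set a; c] \notin U -> [set a; c] \in V ->
  [/\ 0 < incident_flips [set a; b] U s, 0 < incident_flips [set b; c] U s &
      incident_flips [set a; b] U s < 2 -> incident_flips [set b; c] U s < 2 ->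
      lk U [set a; b] = lk U [set b; c]].
Proof.
case/and3P; elim: s U => [|T s IH] U /=.
  by move=> _ _ /eqP-> /negbTE->.
move=> /and3P[tU tT ts] /andP[f ps] lV acU acV.
rewrite !incident_flips_cons.
have [acT|acT] := boolP ([set a; c] \in T).
  have [x [-> -> xa xc]] := flip_creating_ear tU tT f acU acT.
  have [-> ->] := ear_links tT acT.
  have neq (u v : 'I_n) : u != v -> Some u != Some v.
    by apply: contraNN => /eqP[->].
  (* The links move from x to c and to a, so this flip counts for both boundary edges. *)
  by rewrite (neq _ _ xa) (neq _ _ xc).
have [|h1 h2 h] := IH T _ ps lV acT acV; first by rewrite /= tT.
split; [by rewrite addn_gt0 h1 orbT | by rewrite addn_gt0 h2 orbT |].
move=> /(bool_addn_lt2 h1)[/negPn/eqP-> lt1].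
by move=> /(bool_addn_lt2 h2)[/negPn/eqP-> lt2]; apply: h.
Qed.

End Ear.

End Triangulations.

Theorem theorem5 (R : realType) (n : nat) (p : 'I_n -> 'rV[R]_2)
    (U V : {set {set 'I_n}}) (a b c : 'I_n) :
  convex_polygon p ->
  triangulation p U ->
  triangulation p V ->
  clockwise_boundary_edge a b ->
  clockwise_boundary_edge b c ->
  uniq [:: Some a; Some c; lk U [set a; b]; lk U [set b; c]] ->
  [set a; c] \in V ->
  ~ (theta p U V a < 2 /\ theta p U V b < 2).
Proof.
move=> cvx tU tV ab bc; rewrite /= !inE !negb_or !andbT.
move=> /and3P[_ /andP[clk _] lk_neq] acV [ta tb].
(* Otherwise the link of {a, b} in U would be c, against distinctness. *)
have acU : [set a; c] \notin U.
  by apply: contraNN clk => /(ear_links cvx ab bc tU)[-> _].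
have [s gs] := geodesic_exists cvx tU tV.
have [_ _ h] := ear_flip_path cvx ab bc gs.1 acU acV.
move/eqP: lk_neq; apply; apply: h.
  by apply: leq_ltn_trans ta; rewrite (eqP ab) incident_flips_le_theta.
by apply: leq_ltn_trans tb; rewrite (eqP bc) incident_flips_le_theta.
Qed.
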